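(* Let $R$ be a domain, let $S$ be a left Ore set in $R$, and let $(s,r)\in S^{-1}R$ (with $s\in S$, $r\in R$). Then the following are equivalent: (1) $(s,r)\in U(S^{-1}R)$; (2) $(1,r)\in U(S^{-1}R)$; (3) $r\in\rho_{S,R}^{-1}(U(S^{-1}R))$, i.e. $\rho_{S,R}(r)=(1,r)\in U(S^{-1}R)$; (4) $r\in\operatorname{LSat}(S)$.
   Context: Rings are unital and not necessarily commutative; a domain is a nonzero ring without zero divisors. $U(\cdot)$ denotes the group of units of a ring. A subset $S\subseteq R$ is multiplicatively closed if $1\in S$, $0\notin S$ and $st\in S$ for all $s,t\in S$. It is a left Ore set if it is multiplicatively closed and satisfies the left Ore condition: for all $s\in S$, $r\in R$ there exist $\tilde s\in S$, $\tilde r\in R$ with $\tilde s r=\tilde r s$. The left Ore localization $S^{-1}R$ is the set $(S\times R)/\!\sim$, where $(s_1,r_1)\sim(s_2,r_2)$ iff there exist $\tilde s\in S$, $\tilde r\in R$ with $\tilde s s_2=\tilde r s_1$ and $\tilde s r_2=\tilde r r_1$; it is a ring with $(s_1,r_1)+(s_2,r_2)=(\tilde s s_1,\tilde s r_1+\tilde r r_2)$ where $\tilde s\in S,\tilde r\in R$ satisfy $\tilde s s_1=\tilde r s_2$, and $(s_1,r_1)\cdot(s_2,r_2)=(\tilde s s_1,\tilde r r_2)$ where $\tilde s\in S,\tilde r\in R$ satisfy $\tilde r s_2=\tilde s r_1$. The class of $(s,r)$ is again written $(s,r)$ (it represents $s^{-1}r$). The injective structural homomorphism is $\rho_{S,R}:R\to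 S^{-1}R$, $r\mapsto(1,r)$. The left saturation closure of a multiplicatively closed set $S$ is $\operatorname{LSat}(S)=\{r\in R\mid\exists w\in R: wr\in S\}$. *)

(* Defs.v *)
From HB Require Import structures.
From mathcomp Require Import all_boot all_algebra.
From mathcomp Require Import all_classical.

Set Implicit Arguments.
Unset Strict Implicit.
Unset Printing Implicit Defensive.

Import GRing.Theory.
Local Open Scope classical_set_scope.
Local Open Scope quotient_scope.
Local Open Scope ring_scope.

Definition mult_closed (R : nzRingType) (S : set R) : Prop :=
  [/\ S 1, ~ S 0 & forall s t, S s -> S t -> S (s * t)].

Definition left_ore_condition (R : nzRingType) (S : set R) : Prop :=
  forall s r, S s -> exists s' r', S s' /\ s' * r = r' * s.

Definition left_ore_set (R : nzRingType) (S : set R) : Prop :=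
  mult_closed S /\ left_ore_condition S.

Definition LSat (R : nzRingType) (S : set R) : set R :=
  [set r | exists w, S (w * r)].

(* R is a domain: [GRing.integral_domain_axiom] only says that there are no zero
   divisors, it does not include commutativity; R != 0 comes from [nzRingType]. *)
Section OreLocalization.
Variables (R : nzRingType) (domR : GRing.integral_domain_axiom R).
Variables (S : set R) (oreS : left_ore_set S).

Lemma ore_mem1 : 1 \in S. Proof. by apply/mem_set; case: oreS => -[]. Qed.

Lemma ore_memM (s t : S) : val s * val t \in S.
Proof.
case: oreS => -[_ _ SM] _; apply/mem_set/SM; exact: set_mem (valP _).
Qed.

Definition ore_den1 : S := Sub 1 ore_mem1.
Definition ore_denM (s t : S) : S := Sub (val s * val t) (ore_memM s t).

(* ~ on S x R; [ore_relP] shows that it can be tested on any common multiple of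
   the denominators. *)
Definition ore_rel (x y : S * R) : bool :=
  `[< exists (s' : S) (r' : R),
        val s' * val y.1 = r' * val x.1 /\ val s' * y.2 = r' * x.2 >].

Lemma den_neq0 (s : S) : val s != 0.
Proof.
by apply/eqP => s0; case: oreS => -[_ S0 _] _; apply: S0; rewrite -s0;
   apply: set_mem (valP s).
Qed.

Lemma dom_mulfI (a b c : R) : a != 0 -> a * b = a * c -> b = c.
Proof.
move=> a0 /eqP; rewrite -subr_eq0 -mulrBr => /eqP /domR.
by rewrite (negbTE a0) /= subr_eq0 => /eqP.
Qed.

Lemma dom_mulIf (a b c : R) : a != 0 -> b * a = c * a -> b = c.
Proof.
move=> a0 /eqP; rewrite -subr_eq0 -mulrBl => /eqP /domR.
by rewrite (negbTE a0) /= orbF subr_eq0 => /eqP.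
Qed.

Lemma ore_ex (s : S) (r : R) : exists p : S * R, val p.1 * r = p.2 * val s.
Proof.
case: oreS => _ /(_ (val s) r (set_mem (valP s))) [s' [r' [Ss' e]]].
by exists (Sub s' (mem_set Ss'), r').
Qed.

Lemma ore_relP (x y : S * R) :
  reflect (forall a b, a * val x.1 = b * val y.1 -> a * x.2 = b * y.2)
          (ore_rel x y).
Proof.
apply: (iffP idP) => [/asboolP [d [c [e1 e2]]] a b eab|H].
  have [[p q] /= epq] := ore_ex (ore_denM d y.1) (a * val x.1).
  have ea : val p * a = q * c.
    apply: (dom_mulIf (den_neq0 x.1)).
    by rewrite -mulrA epq /= e1 !mulrA.
  have eb : val p * b = q * val d.
    apply: (dom_mulIf (den_neq0 y.1)).
    by rewrite -mulrA -eab epq mulrA.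
  apply: (dom_mulfI (den_neq0 p)).
  by rewrite !mulrA ea eb -!mulrA e2.
apply/asboolP; have [[p q] /= epq] := ore_ex x.1 (val y.1).
by exists p, q; split => //; rewrite (H q (val p)).
Qed.

Lemma ore_rel_refl : reflexive ore_rel.
Proof. by move=> x; apply/ore_relP => a b /(dom_mulIf (den_neq0 _)) ->. Qed.

Lemma ore_rel_sym : symmetric ore_rel.
Proof.
have H x y : ore_rel x y -> ore_rel y x.
  by move=> /ore_relP H; apply/ore_relP => a b /esym/H/esym.
by move=> x y; apply/idP/idP; exact: H.
Qed.

Lemma ore_rel_trans : transitive ore_rel.
Proof.
move=> y x z /ore_relP Hxy /ore_relP Hyz; apply/ore_relP => a b eab.
have [[p q] /= epq] := ore_ex y.1 (a * val x.1).
apply: (dom_mulfI (den_neq0 p)); rewrite !mulrA.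
rewrite (Hxy (val p * a) q) -?mulrA // (Hyz q (val p * b)) ?mulrA //.
by rewrite -epq eab mulrA.
Qed.

Canonical ore_equiv := EquivRel ore_rel ore_rel_refl ore_rel_sym ore_rel_trans.

Definition ore_loc : Type := {eq_quot ore_rel}.
HB.instance Definition _ : EqQuotient _ ore_rel ore_loc :=
  EqQuotient.on ore_loc.
HB.instance Definition _ := Choice.on ore_loc.

Definition ore_frac (s : S) (r : R) : ore_loc := \pi_ore_loc (s, r).

Lemma ore_frac_ind (P : ore_loc -> Prop) :
  (forall s r, P (ore_frac s r)) -> forall x, P x.
Proof. by move=> H x; rewrite -(reprK x); case: (repr x) => s r; apply: H. Qed.

Lemma ore_frac_eq_rel s1 r1 s2 r2 :
  ore_frac s1 r1 = ore_frac s2 r2 <->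
  exists (s' : S) (r' : R),
    val s' * val s2 = r' * val s1 /\ val s' * r2 = r' * r1.
Proof.
split; first by move/eqP; rewrite eqmodE => /asboolP.
by move=> H; apply/eqP; rewrite eqmodE; apply/asboolP.
Qed.

Lemma ore_frac_eq s1 r1 s2 r2 :
  ore_frac s1 r1 = ore_frac s2 r2 <->
  forall a b, a * val s1 = b * val s2 -> a * r1 = b * r2.
Proof.
split; first by move/eqP; rewrite eqmodE => /ore_relP.
by move=> H; apply/eqP; rewrite eqmodE; apply/ore_relP.
Qed.

Definition ore_wit (s : S) (r : R) : S * R := sval (cid (ore_ex s r)).

Lemma ore_witP s r : val (ore_wit s r).1 * r = (ore_wit s r).2 * val s.
Proof. exact: svalP (cid (ore_ex s r)). Qed.

(* The operations use chosen representatives and chosen Ore witnesses; by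
   [ore_addE] and [ore_mulE] below the result depends on neither choice. *)
Definition ore_zero : ore_loc := ore_frac ore_den1 0.

Definition ore_one : ore_loc := ore_frac ore_den1 1.

Definition ore_opp (x : ore_loc) : ore_loc :=
  let: (s, r) := repr x in ore_frac s (- r).

Definition ore_add (x y : ore_loc) : ore_loc :=
  let: (s1, r1) := repr x in let: (s2, r2) := repr y in
  let: (s', r') := ore_wit s2 (val s1) in
  ore_frac (ore_denM s' s1) (val s' * r1 + r' * r2).

Definition ore_mul (x y : ore_loc) : ore_loc :=
  let: (s1, r1) := repr x in let: (s2, r2) := repr y in
  let: (s', r') := ore_wit s2 r1 in
  ore_frac (ore_denM s' s1) (r' * r2).

Lemma repr_ore_frac s r :
  exists2 p, repr (ore_frac s r) = p & ore_frac p.1 p.2 = ore_frac s r.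
Proof.
by exists (repr (ore_frac s r)) => //; rewrite /ore_frac -surjective_pairing reprK.
Qed.

Lemma ore_oppE s r : ore_opp (ore_frac s r) = ore_frac s (- r).
Proof.
rewrite /ore_opp; have [[s1 r1] -> /= /ore_frac_eq e] := repr_ore_frac s r.
by apply/ore_frac_eq => a b /e eab; rewrite !mulrN eab.
Qed.

Lemma ore_addE s1 r1 s2 r2 (s' : S) (r' : R) :
  val s' * val s1 = r' * val s2 ->
  ore_add (ore_frac s1 r1) (ore_frac s2 r2) =
    ore_frac (ore_denM s' s1) (val s' * r1 + r' * r2).
Proof.
move=> e; rewrite /ore_add.
have [[t1 u1] -> /= /ore_frac_eq e1] := repr_ore_frac s1 r1.
have [[t2 u2] -> /= /ore_frac_eq e2] := repr_ore_frac s2 r2.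
case: ore_wit (ore_witP t2 (val t1)) => p q /= epq.
apply/ore_frac_eq => a b /= eab; rewrite !mulrDr !mulrA; congr (_ + _).
  by apply: e1; rewrite -!mulrA.
by apply: e2; rewrite -!mulrA -epq -e.
Qed.

Lemma ore_mulE s1 r1 s2 r2 (s' : S) (r' : R) :
  r' * val s2 = val s' * r1 ->
  ore_mul (ore_frac s1 r1) (ore_frac s2 r2) = ore_frac (ore_denM s' s1) (r' * r2).
Proof.
move=> e; rewrite /ore_mul.
have [[t1 u1] -> /= /ore_frac_eq e1] := repr_ore_frac s1 r1.
have [[t2 u2] -> /= /ore_frac_eq e2] := repr_ore_frac s2 r2.
case: ore_wit (ore_witP t2 u1) => p q /= epq.
apply/ore_frac_eq => a b /= eab; rewrite !mulrA; apply: e2.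
by rewrite -!mulrA e -epq !mulrA; apply: e1; rewrite -!mulrA.
Qed.

Lemma ore_frac_scale (s t : S) (a r : R) : val t = a * val s ->
  ore_frac t (a * r) = ore_frac s r.
Proof.
move=> e; apply/ore_frac_eq => c d; rewrite e !mulrA.
by move=> /(dom_mulIf (den_neq0 s)) ->.
Qed.

Lemma ore_addE1 s r1 r2 :
  ore_add (ore_frac s r1) (ore_frac s r2) = ore_frac s (r1 + r2).
Proof.
rewrite (@ore_addE _ _ _ _ ore_den1 1) //= !mul1r.
by rewrite -[in LHS](mul1r (r1 + r2)); apply: ore_frac_scale.
Qed.

Lemma ore_frac_common x y : exists s r1 r2, x = ore_frac s r1 /\ y = ore_frac s r2.
Proof.
elim/ore_frac_ind: x => s1 r1; elim/ore_frac_ind: y => s2 r2.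
have [[p q] /= e] := ore_ex s2 (val s1).
exists (ore_denM p s1), (val p * r1), (q * r2).
by split; apply: esym; apply: ore_frac_scale.
Qed.

Lemma ore_frac_common3 x y z : exists s r1 r2 r3,
  [/\ x = ore_frac s r1, y = ore_frac s r2 & z = ore_frac s r3].
Proof.
have [t [r1 [r2 [-> ->]]]] := ore_frac_common x y.
elim/ore_frac_ind: z => u r3; have [[p q] /= e] := ore_ex u (val t).
exists (ore_denM p t), (val p * r1), (val p * r2), (q * r3).
by split; apply: esym; apply: ore_frac_scale.
Qed.

Lemma ore_addA : associative ore_add.
Proof.
move=> x y z; have [s [a [b [c [-> -> ->]]]]] := ore_frac_common3 x y z.
by rewrite !ore_addE1 addrA.
Qed.

Lemma ore_addC : commutative ore_add.
Proof.
move=> x y; have [s [a [b [-> ->]]]] := ore_frac_common x y.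
by rewrite !ore_addE1 addrC.
Qed.

Lemma ore_frac0 s : ore_frac s 0 = ore_zero.
Proof. by rewrite -(mulr0 (val s)); apply: ore_frac_scale; rewrite mulr1. Qed.

Lemma ore_add0 : left_id ore_zero ore_add.
Proof.
by elim/ore_frac_ind => s r; rewrite -(ore_frac0 s) ore_addE1 add0r.
Qed.

Lemma ore_addN : left_inverse ore_zero ore_opp ore_add.
Proof.
by elim/ore_frac_ind => s r; rewrite ore_oppE ore_addE1 addNr ore_frac0.
Qed.

HB.instance Definition _ :=
  GRing.isZmodule.Build ore_loc ore_addA ore_addC ore_add0 ore_addN.

Lemma ore_mulA : associative ore_mul.
Proof.
elim/ore_frac_ind => s1 r1; elim/ore_frac_ind => s2 r2; elim/ore_frac_ind => s3 r3.
have [[c d] /= ecd] := ore_ex s3 r2.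
have [[e f] /= eef] := ore_ex (ore_denM c s2) r1.
rewrite (ore_mulE _ _ (esym ecd)) (@ore_mulE s1 r1 (ore_denM c s2) (d * r3) e f) //.
rewrite (@ore_mulE s1 r1 s2 r2 e (f * val c)); last by rewrite -mulrA.
rewrite (@ore_mulE _ _ s3 r3 ore_den1 (f * d)) /=; last first.
  by rewrite mul1r -!mulrA ecd.
by rewrite mulrA; congr ore_frac; apply: val_inj; rewrite /= mul1r.
Qed.

Lemma ore_mul1l : left_id ore_one ore_mul.
Proof.
elim/ore_frac_ind => s r; rewrite (@ore_mulE _ _ _ _ s 1) /=; last first.
  by rewrite mul1r mulr1.
by apply: ore_frac_scale; rewrite /= mulr1 mul1r.
Qed.

Lemma ore_mul1r : right_id ore_one ore_mul.
Proof.
elim/ore_frac_ind => s r; rewrite (@ore_mulE _ _ _ _ ore_den1 r) /=; last first.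
  by rewrite mul1r mulr1.
by rewrite mulr1 -[X in ore_frac _ X]mul1r; apply: ore_frac_scale.
Qed.

Lemma ore_mulDl : left_distributive ore_mul ore_add.
Proof.
move=> x y; elim/ore_frac_ind => t u.
have [s [a [b [-> ->]]]] := ore_frac_common x y.
have [[p q] /= e1] := ore_ex t a.
have [[p' q'] /= e2] := ore_ex t (val p * b).
rewrite ore_addE1.
rewrite (@ore_mulE _ _ _ _ (ore_denM p' p) (val p' * q + q')) /=; last first.
  by rewrite mulrDl mulrDr -!mulrA -e1 e2.
rewrite (@ore_mulE _ a _ _ (ore_denM p' p) (val p' * q)) /=; last first.
  by rewrite -!mulrA e1.
rewrite (@ore_mulE _ b _ _ (ore_denM p' p) q') /=; last by rewrite -!mulrA e2.
by rewrite ore_addE1 mulrDl.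
Qed.

Lemma ore_mulDr : right_distributive ore_mul ore_add.
Proof.
elim/ore_frac_ind => t u x y.
have [s [a [b [-> ->]]]] := ore_frac_common x y.
have [[p q] /= e1] := ore_ex s u.
by rewrite ore_addE1 !(ore_mulE _ _ (esym e1)) ore_addE1 mulrDr.
Qed.

Lemma ore_one_neq0 : ore_one != ore_zero.
Proof.
apply/eqP => /ore_frac_eq /(_ 1 1 erefl) /eqP.
by rewrite !mul1r oner_eq0.
Qed.

HB.instance Definition _ := GRing.Zmodule_isNzRing.Build ore_loc
  ore_mulA ore_mul1l ore_mul1r ore_mulDl ore_mulDr ore_one_neq0.

(* Being a unit is decided classically, so that [GRing.unit] is available. *)
Definition ore_unit (x : ore_loc) : bool :=
  `[< exists y : ore_loc, y * x = 1 /\ x * y = 1 >].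

Definition ore_inv (x : ore_loc) : ore_loc :=
  if pselect (exists y : ore_loc, y * x = 1 /\ x * y = 1) is left e
  then sval (cid e) else x.

Lemma ore_mulVr : {in ore_unit, left_inverse 1 ore_inv *%R}.
Proof.
by move=> x /asboolP xU; rewrite /ore_inv; case: pselect => // e;
   case: (cid e) => y [].
Qed.

Lemma ore_mulrV : {in ore_unit, right_inverse 1 ore_inv *%R}.
Proof.
by move=> x /asboolP xU; rewrite /ore_inv; case: pselect => // e;
   case: (cid e) => y [].
Qed.

Lemma ore_unitP (x y : ore_loc) : y * x = 1 /\ x * y = 1 -> x \in ore_unit.
Proof. by move=> e; apply/asboolP; exists y. Qed.

Lemma ore_invr_out : {in [predC ore_unit], ore_inv =1 id}.
Proof.
by move=> x /asboolP xU; rewrite /ore_inv; case: pselect.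
Qed.

HB.instance Definition _ := GRing.NzRing_hasMulInverse.Build ore_loc
  ore_mulVr ore_mulrV ore_unitP ore_invr_out.

Definition ore_rho (r : R) : ore_loc := ore_frac ore_den1 r.

Lemma ore_rho_is_zmod_morphism : zmod_morphism ore_rho.
Proof.
move=> a b; rewrite /ore_rho [LHS]/=.
change (ore_frac ore_den1 (a - b) =
  ore_add (ore_frac ore_den1 a) (ore_opp (ore_frac ore_den1 b))).
by rewrite ore_oppE ore_addE1.
Qed.

Lemma ore_rho_is_monoid_morphism : monoid_morphism ore_rho.
Proof.
split=> // a b; change (ore_rho (a * b) = ore_mul (ore_rho a) (ore_rho b)).
rewrite /ore_rho (@ore_mulE _ _ _ _ ore_den1 a) /=; last by rewrite mul1r mulr1.
by congr ore_frac; apply: val_inj; rewrite /= mulr1.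
Qed.

HB.instance Definition _ :=
  GRing.isZmodMorphism.Build R ore_loc ore_rho ore_rho_is_zmod_morphism.
HB.instance Definition _ :=
  GRing.isMonoidMorphism.Build R ore_loc ore_rho ore_rho_is_monoid_morphism.

Lemma ore_rho_inj : injective ore_rho.
Proof. by move=> a b /ore_frac_eq /(_ 1 1 erefl); rewrite !mul1r. Qed.

End OreLocalization.

Arguments ore_frac {R} domR {S} oreS s r.
Arguments ore_rho {R} domR {S} oreS r.
Arguments ore_den1 {R S} oreS.

(* Main.v *)
(* With r/1 the image of r, one has s^-1 r = (s/1)^-1 (r/1), so s^-1 r is a unit
   iff r/1 is.  A left inverse t^-1 w of r/1 forces w r = t, an element of S.
   Conversely w r = t in S makes t^-1 w a left inverse of r/1, and it is
   two-sided because r/1 can be cancelled on the right. *)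

Require Import Defs.
From HB Require Import structures.
From mathcomp Require Import all_boot all_algebra.
From mathcomp Require Import all_classical.

Set Implicit Arguments.
Unset Strict Implicit.
Unset Printing Implicit Defensive.

Import GRing.Theory.
Local Open Scope classical_set_scope.
Local Open Scope ring_scope.

Section OreUnits.
Variables (R : nzRingType) (domR : GRing.integral_domain_axiom R).
Variables (S : set R) (oreS : left_ore_set S).
Implicit Types (s : S) (r w : R).

Local Notation frac := (ore_frac domR oreS).
Local Notation rho := (ore_rho domR oreS).

Lemma ore_frac_mul_rho s w r : frac s w * rho r = frac s (w * r).
Proof.
rewrite -[LHS]/(ore_mul (frac s w) (rho r)).
(* The right factor has denominator 1, so [w * 1 = 1 * w] already serves as the Ore witness. *)
rewrite (@ore_mulE _ _ _ _ _ _ _ _ (ore_den1 oreS) w) /=; last first.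
  by rewrite mulr1 mul1r.
by congr ore_frac; apply: val_inj; rewrite /= mul1r.
Qed.

Lemma ore_rho_mul_frac s r : rho (val s) * frac s r = rho r.
Proof.
rewrite -[LHS]/(ore_mul (rho (val s)) (frac s r)).
rewrite (@ore_mulE _ _ _ _ _ _ _ _ (ore_den1 oreS) 1) //= mul1r.
by congr ore_frac; apply: val_inj; rewrite /= mul1r.
Qed.

Lemma ore_frac_eq1 s r : frac s r = 1 <-> r = val s.
Proof.
(* Since 1 has denominator 1, the common multiple [1 * val s = val s * 1] compares the numerators
   directly. *)
split=> [/ore_frac_eq /(_ 1 (val s)) | ->].
  by rewrite /= !mul1r !mulr1; apply.
by apply/ore_frac_eq => a b /= ->.
Qed.

Lemma ore_frac_eq0 s r : frac s r = 0 <-> r = 0.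
Proof.
split=> [/ore_frac_eq /(_ 1 (val s)) | ->]; last exact: ore_frac0.
by rewrite /= !mul1r mulr1 mulr0; apply.
Qed.

Lemma ore_rho_den_unit s : rho (val s) \is a GRing.unit.
Proof.
apply/unitrP; exists (frac s 1); split; last exact: ore_rho_mul_frac.
by rewrite ore_frac_mul_rho mul1r; apply/ore_frac_eq1.
Qed.

Lemma ore_frac_unitE s r :
  (frac s r \is a GRing.unit) = (rho r \is a GRing.unit).
Proof. by rewrite -(ore_rho_mul_frac s r) unitrMr // ore_rho_den_unit. Qed.

(** Multiplying by [rho r] only changes the numerator [w] into [w * r], so cancellation is inherited
    from the domain [R]. *)
Lemma ore_mul_rho_eq0 r x : r != 0 -> x * rho r = 0 -> x = 0.
Proof.
move=> r0; elim/ore_frac_ind: x => s w.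
rewrite ore_frac_mul_rho => /ore_frac_eq0 /domR.
by rewrite (negbTE r0) orbF => /eqP ->; apply/ore_frac_eq0.
Qed.

Lemma ore_rho_unit_LSat r : rho r \is a GRing.unit <-> LSat S r.
Proof.
split=> [/unitrP [y []] | [w /mem_set Swr]].
  elim/ore_frac_ind: y => t w; rewrite ore_frac_mul_rho => /ore_frac_eq1 e _.
  by exists w; rewrite e; apply: set_mem (valP t).
(* Otherwise [w * r] would be 0, which is not in [S]. *)
have r0 : r != 0.
  by apply: contraNneq (den_neq0 oreS (Sub (w * r) Swr)) => /= ->; rewrite mulr0.
have yr1 : frac (Sub (w * r) Swr) w * rho r = 1.
  by rewrite ore_frac_mul_rho; apply/ore_frac_eq1.
apply/unitrP; exists (frac (Sub (w * r) Swr) w); split=> //.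
(* With [y] the left inverse, [(rho r * y - 1) * rho r = rho r * (y * rho r) - rho r = 0]. *)
apply/subr0_eq/(ore_mul_rho_eq0 r0).
by rewrite mulrBl -mulrA yr1 mulr1 mul1r subrr.
Qed.

End OreUnits.

Theorem proposition2p4 (R : nzRingType) (domR : GRing.integral_domain_axiom R)
    (S : set R) (oreS : left_ore_set S) (s : S) (r : R) :
  [<-> ore_frac domR oreS s r \is a GRing.unit;
       ore_frac domR oreS (ore_den1 oreS) r \is a GRing.unit;
       (ore_rho domR oreS @^-1` [set x | x \is a GRing.unit]) r;
       LSat S r].
Proof.
tfae.
- by rewrite !ore_frac_unitE.
(* [ore_rho] is by definition the fraction with denominator 1. *)
- by [].
- by move=> /ore_rho_unit_LSat.
- by rewrite ore_frac_unitE => /(ore_rho_unit_LSat domR oreS).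
Qed.
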